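(* Let $K=K_1\times\dots\times K_n$, where $K_j=\{x\in\mathbb{R}^{n_j}:x_{n_j}\ge\|(x_1,\dots,x_{n_j-1})^T\|\}$ is the ice-cream cone, let $A_j\in\mathbb{R}^{m\times n_j}$, $c_j\in\mathbb{R}^{n_j}$ for $j=1,\dots,n$, and $b\in\mathbb{R}^m$. Consider the second order cone program: minimize $\sum_{j=1}^n c_j^Tx_j$ subject to $\sum_{j=1}^nA_jx_j=b$, $x_j\in K_j$ for $j=1,\dots,n$, with optimal value $\hat f_p$, and its dual: maximize $b^Ty$ subject to $-A_j^Ty+c_j\in K_j$ for $j=1,\dots,n$, $y\in\mathbb{R}^m$, with optimal value $\hat f_d$. Assume that the dual boundedness qualification (DBQ) holds with bound $\overline{y}\in\mathbb{R}^m$. Let $\tilde x=(\tilde x_1;\dots;\tilde x_n)\in K$ and let $\overline{r}\in\mathbb{R}^m$ satisfy $$\Big|\sum_{j=1}^nA_j\tilde x_j-b\Big|\le\overline{r}.$$ Then: (a) The dual optimal value is bounded from above by $$\hat f_d\ \le\ \sum_{j=1}^nc_j^T\tilde x_j+\overline{y}^T\overline{r}=:\overline{f}_d.$$ (b) If $\overline{r}=0$, then $\tilde x$ is primal feasible and $\hat f_p\le\overline{f}_d=\sum_{j=1}^nc_j^T\tilde x_j$; if moreover $\tilde x$ is primal optimal, then $\hat f_p=\overline{f}_d$.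
   Context: Norms are Euclidean. In $\mathbb{R}^m$, absolute value and $\le$ are componentwise. $\hat f_p$ is the infimum of the primal objective ($+\infty$ if infeasible); $\hat f_d$ is the supremum of the dual objective ($-\infty$ if infeasible). DBQ (with bound $\overline{y}$): either (i) the dual problem is infeasible (in which case no condition is imposed on $\overline{y}$), or (ii) $\hat f_d$ is finite and for every $\varepsilon>0$ there exists a dual feasible $y(\varepsilon)$ with $|y(\varepsilon)|\le\overline{y}$ and $\hat f_d-b^Ty(\varepsilon)\le\varepsilon$. *)

(* Defs.v *)
From mathcomp Require Import all_boot all_order all_algebra.
From mathcomp Require Import all_classical all_reals ereal.

Set Implicit Arguments.
Unset Strict Implicit.
Unset Printing Implicit Defensive.

Import Order.TTheory GRing.Theory Num.Theory.
Local Open Scope classical_set_scope.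
Local Open Scope ring_scope.

(* The canonical norm of matrices in MathComp-Analysis is the sup norm, and the
   inner product of spectral.v needs a closed field; hence these two. *)
Definition dot (R : realType) (p : nat) (u v : 'cV[R]_p) : R :=
  (u^T *m v) 0 0.

Definition enorm (R : realType) (p : nat) (u : 'cV[R]_p) : R :=
  Num.sqrt (dot u u).

Definition vabs (R : realType) (p : nat) (u : 'cV[R]_p) : 'cV[R]_p :=
  map_mx Num.norm u.

Definition vle (R : realType) (p : nat) (u v : 'cV[R]_p) : Prop :=
  forall i, u i 0 <= v i 0.

(* [row' ord_max x] is x with its last coordinate removed.  The dimension p.+1
   ranges over the positive integers; for p = 0 the cone is [0, +oo[. *)
Definition ice_cream_cone (R : realType) (p : nat) : set 'cV[R]_p.+1 :=
  [set x | enorm (row' ord_max x) <= x ord_max 0].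

(* A point of the product of the R^(n_j) is a dependent function; n_j = (k j).+1. *)
Section SecondOrderConeProgram.
Variables (R : realType) (m n : nat) (k : 'I_n -> nat).
Variable A : forall j, 'M[R]_(m, (k j).+1).
Variable b : 'cV[R]_m.
Variable c : forall j, 'cV[R]_(k j).+1.

Definition in_cone_product (x : forall j, 'cV[R]_(k j).+1) : Prop :=
  forall j, ice_cream_cone (x j).

Definition primal_objective (x : forall j, 'cV[R]_(k j).+1) : R :=
  \sum_(j < n) dot (c j) (x j).

Definition primal_feasible (x : forall j, 'cV[R]_(k j).+1) : Prop :=
  \sum_(j < n) A j *m x j = b /\ in_cone_product x.

Definition primal_value : \bar R :=
  ereal_inf [set (primal_objective x)%:E | x in [set x | primal_feasible x]].

Definition primal_optimal (x : forall j, 'cV[R]_(k j).+1) : Prop :=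
  primal_feasible x /\
  forall z, primal_feasible z -> primal_objective x <= primal_objective z.

Definition dual_feasible (y : 'cV[R]_m) : Prop :=
  in_cone_product (fun j => - (A j)^T *m y + c j).

Definition dual_value : \bar R :=
  ereal_sup [set (dot b y)%:E | y in [set y | dual_feasible y]].

Definition DBQ (ybar : 'cV[R]_m) : Prop :=
  ~ (exists y, dual_feasible y) \/
  (dual_value \is a fin_num /\
   forall eps : R, 0 < eps ->
     exists y, [/\ dual_feasible y, vle (vabs y) ybar &
                   (dual_value - (dot b y)%:E <= eps%:E)%E]).

End SecondOrderConeProgram.

(* Main.v *)
Require Import Defs.
From mathcomp Require Import all_boot all_order all_algebra.
From mathcomp Require Import all_classical all_reals ereal.
From mathcomp Require Import ring.

Import Order.TTheory GRing.Theory Num.Theory.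
Local Open Scope ring_scope.

(** The bound is weak duality with a residual. Put [r = \sum_j A_j x_j - b] for
    the point [x] of the cone product. For a dual feasible [y] with slacks
    [s_j = c_j - A_j^T y], moving each [A_j] across the inner product gives
    [b^T y = c^T x - \sum_j s_j^T x_j - r^T y]. The cone lies in its own dual
    cone ([ice_cream_cone_dot_ge0], a consequence of Cauchy-Schwarz), so the
    terms [s_j^T x_j] only decrease the right-hand side, and
    [b^T y <= c^T x - r^T y] ([dual_objective_le]). When [|y| <= ybar] and
    [|r| <= rbar], the residual term is at most [ybar^T rbar]. The
    qualification says that such bounded [y] already approach the dual value,
    which therefore obeys the same bound, unless the dual is infeasible and its
    value is [-oo].

    When [rbar = 0] the residual vanishes, so that [x] is primal feasible and
    the bound is its objective value; the claims on the primal value are then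
    those for the infimum of a set at one of its elements, or at its minimum. *)

Section InnerProduct.
Context {R : realType}.

Lemma dotE {p} (u v : 'cV[R]_p) : dot u v = \sum_i u i 0 * v i 0.
Proof. by rewrite /dot mxE; apply: eq_bigr => i _; rewrite mxE. Qed.

Lemma dotC {p} (u v : 'cV[R]_p) : dot u v = dot v u.
Proof. by rewrite !dotE; apply: eq_bigr => i _; rewrite mulrC. Qed.

Lemma dotDl {p} (u v w : 'cV[R]_p) : dot (u + v) w = dot u w + dot v w.
Proof. by rewrite /dot linearD mulmxDl mxE. Qed.

Lemma dotNl {p} (u w : 'cV[R]_p) : dot (- u) w = - dot u w.
Proof. by rewrite /dot linearN mulNmx mxE. Qed.

Lemma dotZl {p} (a : R) (u w : 'cV[R]_p) : dot (a *: u) w = a * dot u w.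
Proof. by rewrite /dot linearZ -scalemxAl mxE. Qed.

Lemma dot_suml {p n} (u : 'I_n -> 'cV[R]_p) w :
  dot (\sum_j u j) w = \sum_j dot (u j) w.
Proof. by rewrite /dot linear_sum mulmx_suml summxE. Qed.

Lemma dot_adjoint {p q} (M : 'M[R]_(p, q)) (u : 'cV[R]_p) (v : 'cV[R]_q) :
  dot (M^T *m u) v = dot (M *m v) u.
Proof. by rewrite [RHS]dotC /dot trmx_mul trmxK mulmxA. Qed.

Lemma dotxx_ge0 {p} (u : 'cV[R]_p) : 0 <= dot u u.
Proof. by rewrite dotE; apply: sumr_ge0 => i _; rewrite -expr2 sqr_ge0. Qed.

Lemma enorm_ge0 {p} (u : 'cV[R]_p) : 0 <= enorm u.
Proof. exact: sqrtr_ge0. Qed.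

Lemma sqr_enorm {p} (u : 'cV[R]_p) : enorm u ^+ 2 = dot u u.
Proof. by rewrite sqr_sqrtr ?dotxx_ge0. Qed.

Lemma enorm_eq0 {p} (u : 'cV[R]_p) : enorm u = 0 -> u = 0.
Proof.
move=> u0; have := sqr_enorm u; rewrite u0 expr0n /= dotE => /esym/eqP.
rewrite psumr_eq0 => [|i _]; last by rewrite -expr2 sqr_ge0.
move=> /allP u_eq0; apply/matrixP => i j; rewrite ord1 mxE; apply/eqP.
by have := u_eq0 i (mem_index_enum i); rewrite -expr2 sqrf_eq0.
Qed.

Lemma dot0l {p} (w : 'cV[R]_p) : dot 0 w = 0.
Proof. by rewrite /dot trmx0 mul0mx mxE. Qed.

(** The lower half of Cauchy-Schwarz: for nonzero [u] and [v] it expresses that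
    the vector [enorm v *: u + enorm u *: v] has a nonnegative inner product
    with itself. *)
Lemma dot_ge_enorm {p} (u v : 'cV[R]_p) : - (enorm u * enorm v) <= dot u v.
Proof.
have [/enorm_eq0 ->|u0] := eqVneq (enorm u) 0.
  by rewrite dot0l oppr_le0 mulr_ge0 ?enorm_ge0.
have [/enorm_eq0 ->|v0] := eqVneq (enorm v) 0.
  by rewrite dotC dot0l oppr_le0 mulr_ge0 ?enorm_ge0.
have uv_gt0 : 0 < enorm u * enorm v.
  by rewrite mulr_gt0 // lt_def enorm_ge0 andbT.
have := dotxx_ge0 (enorm v *: u + enorm u *: v).
set w := _ + _; have -> : dot w w =
    2 * (enorm u * enorm v) * (dot u v + enorm u * enorm v).
  rewrite /w dotDl !dotZl !(dotC _ (_ + _)) !dotDl !dotZl -!sqr_enorm (dotC v u).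
  by ring.
rewrite pmulr_rge0; first by rewrite -lerBlDr sub0r.
by rewrite mulr_gt0 ?ltr0n.
Qed.

(** The cone is contained in its dual cone: the last coordinates contribute at
    least the product of the norms of the leading parts, which is as far below
    zero as the inner product of these parts can go. *)
Lemma ice_cream_cone_dot_ge0 {p} (u v : 'cV[R]_p.+1) :
  ice_cream_cone u -> ice_cream_cone v -> 0 <= dot u v.
Proof.
rewrite /ice_cream_cone /= => hu hv.
have -> : dot u v =
    dot (row' ord_max u) (row' ord_max v) + u ord_max 0 * v ord_max 0.
  rewrite !dotE big_ord_recr /=; congr (_ + _).
  apply: eq_bigr => i _; rewrite !mxE.
  have -> // : lift ord_max i = widen_ord (leqnSn p) i.
  by apply/val_inj; exact: lift_max.
rewrite addrC -lerBlDr sub0r.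
have le_norms := ler_pM (enorm_ge0 _) (enorm_ge0 _) hu hv.
by apply: (le_trans _ le_norms); rewrite lerNl dot_ge_enorm.
Qed.

Lemma dot_le_vabs {p} (u v ubar vbar : 'cV[R]_p) :
  vle (vabs u) ubar -> vle (vabs v) vbar -> - dot u v <= dot ubar vbar.
Proof.
move=> hu hv; rewrite !dotE -sumrN; apply: ler_sum => i _.
apply: le_trans (ler_norm _) _; rewrite normrN normrM.
by apply: ler_pM => //; [have := hu i | have := hv i]; rewrite mxE.
Qed.

End InnerProduct.

(** Weak duality for a point [x] that may violate the equality constraints: the
    right-hand side exceeds the left one by exactly the sum of the inner
    products of the dual slacks with the [x j]. *)
Lemma dual_objective_le {R : realType} {m n : nat} {k : 'I_n -> nat}
    (A : forall j, 'M[R]_(m, (k j).+1)) (b : 'cV[R]_m)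
    (c : forall j, 'cV[R]_(k j).+1) (x : forall j, 'cV[R]_(k j).+1)
    (y : 'cV[R]_m) :
  in_cone_product x -> dual_feasible A c y ->
  dot b y <= primal_objective c x - dot (\sum_(j < n) A j *m x j - b) y.
Proof.
move=> hx hy; rewrite dotDl dotNl opprD opprK addrA lerDr dot_suml -sumrB.
apply: sumr_ge0 => j _.
have := ice_cream_cone_dot_ge0 _ _ (hy j) (hx j).
by rewrite dotDl mulNmx dotNl dot_adjoint addrC.
Qed.

Theorem corollary5p2 (R : realType) (m n : nat) (k : 'I_n -> nat)
    (A : forall j, 'M[R]_(m, (k j).+1)) (b : 'cV[R]_m)
    (c : forall j, 'cV[R]_(k j).+1)
    (ybar : 'cV[R]_m) (hDBQ : DBQ A b c ybar)
    (xt : forall j, 'cV[R]_(k j).+1) (hxt : in_cone_product xt)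
    (rbar : 'cV[R]_m)
    (hrbar : vle (vabs (\sum_(j < n) A j *m xt j - b)) rbar) :
  let fbar := primal_objective c xt + dot ybar rbar in
  (dual_value A b c <= fbar%:E)%E /\
  (rbar = 0 ->
    [/\ primal_feasible A b xt,
        (primal_value A b c <= fbar%:E)%E,
        fbar = primal_objective c xt &
        primal_optimal A b c xt -> primal_value A b c = fbar%:E]).
Proof.
move=> fbar; split.
  case: hDBQ => [infeas|[fin approx]].
    by apply: ge_ereal_sup => z [y hy _]; case: infeas; exists y.
  apply/lee_addgt0Pr => eps /approx [y [hy ley]].
  rewrite leeBlDr // => /le_trans; apply.
  rewrite addeC leeD2r // lee_fin.
  apply: le_trans (dual_objective_le _ b _ _ _ hxt hy) _.
  by rewrite lerD2l dotC dot_le_vabs.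
move=> r0.
have fbarE : fbar = primal_objective c xt by rewrite /fbar r0 dotC dot0l addr0.
have feas : primal_feasible A b xt.
  split=> //; apply/eqP; rewrite -subr_eq0; apply/eqP/matrixP => i j.
  by have := hrbar i; rewrite r0 ord1 [vabs _ _ _]mxE !mxE normr_le0 => /eqP.
have le_val : (primal_value A b c <= fbar%:E)%E.
  by rewrite fbarE; apply: ereal_inf_lbound; exists xt.
split=> // -[_ opt]; apply/le_anti; rewrite le_val /=.
by apply: le_ereal_inf_tmp => _ [z hz <-]; rewrite fbarE lee_fin opt.
Qed.
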